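(* Let $k=k(n)$, and for each $n$ fix an edge-coloring of the complete bipartite graph $K_{n,n}$ (not necessarily proper) in which no color appears on more than $n/k$ edges. Let $\mathcal{M}$ be the set of (unordered) pairs of non-incident edges of $K_{n,n}$ that have the same color, and let $\mu=\frac{|\mathcal{M}|}{n(n-1)}$. Let $M$ be a uniformly random perfect matching of $K_{n,n}$ and let $X_M$ be the indicator variable of the event that $M$ is rainbow. (1) If $k\ge 12$, then there exist constants $c_1<1<c_2$ depending only on $k$ such that $$e^{-c_2\mu}\le \Pr(X_M=1)\le e^{-c_1\mu}.$$ (2) In particular, if $k=\omega(1)$ (as $n\to\infty$), then $$\Pr(X_M=1)=e^{-(1+o(1))\mu}.$$ (3) Moreover, if $k=\omega(n^{1/2})$, then $$\Pr(X_M=1)=e^{-\mu}(1+o(1)).$$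
   Context: A perfect matching of an edge-colored $K_{n,n}$ is rainbow if no two of its edges have the same color. Two edges are non-incident (independent) if they share no end vertex. Edge-colorings need not be proper. Asymptotic notation $o(1)$, $\omega(\cdot)$ refers to $n\to\infty$. *)

(* Defs.v *)
From HB Require Import structures.
From mathcomp Require Import all_boot all_order all_algebra.
From mathcomp Require Import all_classical all_reals all_analysis.

Set Implicit Arguments.
Unset Strict Implicit.
Unset Printing Implicit Defensive.

Import Order.TTheory GRing.Theory Num.Theory.
Import numFieldNormedType.Exports.

Local Open Scope ring_scope.

Section RainbowMatchings.

Variable n : nat.

(* K_{n,n}: the left vertices are [inl i], the right vertices [inr j], and the
   pair (i, j) is the edge joining them. *)
Definition vertex : finType := ('I_n + 'I_n)%type.
Definition edge : finType := ('I_n * 'I_n)%type.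

Definition ends (e : edge) : {set vertex} := [set inl e.1; inr e.2].

Definition non_incident (e f : edge) : bool := [disjoint ends e & ends f].

Definition perfect_matching (M : {set edge}) : bool :=
  [forall e in M, forall f in M, (e != f) ==> non_incident e f]
  && [forall v : vertex, exists e in M, v \in ends e].

Definition perfect_matchings : {set {set edge}} :=
  [set M : {set edge} | perfect_matching M].

Section Coloring.

Variables (C : eqType) (chi : edge -> C).

Definition rainbow (M : {set edge}) : bool :=
  [forall e in M, forall f in M, (e != f) ==> (chi e != chi f)].

(* Unordered pairs are two-element edge sets; e and f are automatically
   distinct, since no edge is non-incident to itself. *)
Definition conflicts : {set {set edge}} :=
  [set P : {set edge} | [exists e : edge, exists f : edge,
     [&& P == [set e; f], non_incident e f & chi e == chi f]]].

Variable R : realType.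

Definition color_bounded (k : R) : Prop :=
  forall c : C, #|[set e : edge | chi e == c]|%:R <= n%:R / k.

(* For n <= 1 the denominator vanishes, and then the value is 0. *)
Definition mu : R := #|conflicts|%:R / (n%:R * (n%:R - 1)).

(* Probability that a uniformly random perfect matching is rainbow. *)
Definition prob_rainbow : R :=
  #|[set M in perfect_matchings | rainbow M]|%:R / #|perfect_matchings|%:R.

End Coloring.

End RainbowMatchings.

Arguments mu {n C} chi R.
Arguments prob_rainbow {n C} chi R.
Arguments color_bounded {n C} chi {R} k.

(* Main.v *)
(* A perfect matching is the graph of a permutation, and it is rainbow iff it
   contains no conflict, so everything reduces to counting the permutations that
   avoid a set S of conflicts.  Put p = 1 / (n (n - 1)), the probability of a
   single conflict; then mu = p |conflicts|.

   Lower bound: the lopsided local lemma.  Composing with transpositions shows that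
   containing a conflict Q is negatively correlated with avoiding conflicts that
   are vertex-disjoint from Q, and Q meets at most 4 n (n - 1) / k conflicts;
   k >= 12 makes the weight (1 + 24 / k) p admissible.

   Upper bound: it suffices that Pr(Q | S avoided) >= (1 - 32 / k) p for Q not in S,
   as the conflicts can then be avoided one after the other.  Given a random
   permutation avoiding S, force the two edges of Q into it by two transpositions.
   This fails only when a transposition creates a conflict in S, and by the local
   lemma a set of r <= 4 edges is present, given that S is avoided, with probability
   at most 4 / n^r, so a union bound makes failure O(1 / k). *)
Require Import Defs.
From HB Require Import structures.
From mathcomp Require Import all_boot all_order all_algebra.
From mathcomp Require Import reals sequences exp.
From mathcomp Require Import perm lra ring zify.

Set Implicit Arguments.
Unset Strict Implicit.
Unset Printing Implicit Defensive.

Import Order.TTheory GRing.Theory Num.Theory.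

Local Open Scope ring_scope.

(** * Numerical inequalities for the local lemma weight and for falling factorials *)

Lemma expR_ge_inv (R : realType) (y : R) : y < 1 -> expR (- (y / (1 - y))) <= 1 - y.
Proof.
move=> y1; have y0 : 0 < 1 - y by rewrite subr_gt0.
rewrite expRN -[leRHS]invrK lef_pV2 ?posrE ?invr_gt0 ?expR_gt0//.
apply: le_trans (expR_ge1Dx _); rewrite le_eqVlt; apply/orP; left; apply/eqP.
by field; rewrite gt_eqF.
Qed.

Lemma expR_le_inv (R : realType) (y : R) : y < 1 -> expR y <= (1 - y)^-1.
Proof.
move=> y1; have y0 : 0 < 1 - y by rewrite subr_gt0.
rewrite -[expR y]invrK lef_pV2 ?posrE ?invr_gt0 ?expR_gt0// -expRN.
exact: expR_ge1Dx.
Qed.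

(** The left side is convex in [t], and the right side is its chord over [0, 1]. *)
Lemma expr_chord (R : realFieldType) (b t : R) m : 0 <= b -> 0 <= t <= 1 ->
  (1 + b * t) ^+ m <= 1 + ((1 + b) ^+ m - 1) * t.
Proof.
move=> b0 /andP[t0 t1]; elim: m => [|m IH]; first by rewrite !expr0 subrr mul0r addr0.
rewrite !exprS; have bt : 0 <= 1 + b * t by rewrite addr_ge0// mulr_ge0.
apply: (le_trans (ler_wpM2l bt IH)); have : 1 <= (1 + b) ^+ m.
  by rewrite exprn_ege1// lerDl.
move: (_ ^+ m) => B B1.
have : 0 <= b * (B - 1) * t * (1 - t).
  by rewrite !mulr_ge0 ?subr_ge0.
lra.
Qed.

(** With [t = 12 / k] and [y = (1 + 2 t) p], the point is that (1 + 2 t) (1 - y)^D is at least 1.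
    Since [y D <= t], the power is at least exp(- 44 t / 43), so exp(44 t / 43) <= 1 + 2 t suffices;
    this is convexity on [0, 1] together with e^(44/43) < 3. *)
Lemma local_lemma_weight (R : realType) (k p : R) D : 12 <= k -> 0 <= p <= 132^-1 ->
  D%:R * p <= 4 / k ->
  p <= (1 + 24 / k) * p * (1 - (1 + 24 / k) * p) ^+ D.
Proof.
move=> k12 /andP[p0 p1] Dp; have k0 : 0 < k by lra.
pose t := 12 / k.
have t0 : 0 <= t by rewrite divr_ge0//; lra.
have t1 : t <= 1 by rewrite ler_pdivrMr// mul1r.
have -> : 24 / k = 2 * t by rewrite /t; lra.
have {}Dp : D%:R * p <= t / 3 by rewrite /t; lra.
set y := (1 + 2 * t) * p.
have y0 : 0 <= y by rewrite mulr_ge0//; lra.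
have y1 : y <= 44^-1.
  have : (1 + 2 * t) * p <= 3 * 132^-1 by apply: ler_pM => //; lra.
  by rewrite /y; lra.
have yD : y * D%:R <= t.
  have : (1 + 2 * t) * (D%:R * p) <= 3 * (t / 3).
    by apply: ler_pM => //; rewrite ?mulr_ge0//; lra.
  by rewrite /y; lra.
rewrite [(1 + _) * p * _]mulrAC ler_peMl//.
(* Here 44/43 is 1 / (1 - 1/44), by [y1]. *)
have yy : y / (1 - y) <= 44 / 43 * y.
  rewrite ler_pdivrMr; last by lra.
  have : 0 <= y * (44^-1 - y) by rewrite mulr_ge0// subr_ge0.
  by lra.
have powD : expR (- (44 / 43 * t)) <= (1 - y) ^+ D.
  apply: (@le_trans _ _ (expR (- (y / (1 - y))) ^+ D)); last first.
    by apply: lerXn2r; rewrite ?nnegrE ?expR_ge0 ?expR_ge_inv//; lra.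
  rewrite -expRM_natl ler_expR mulrN lerN2.
  apply: (@le_trans _ _ (D%:R * (44 / 43 * y))); first by rewrite ler_wpM2l.
  by lra.
have exp_le : expR (44 / 43 * t) <= 1 + 2 * t.
  (* Cutting the exponent into sixteen parts makes [expR_le_inv] sharp enough: 1 / (1 - 11/172) = 1
     + 11/161, and (1 + 11/161)^16 < 3. *)
  have -> : 44 / 43 * t = 16%:R * (11 / 172 * t) by lra.
  rewrite expRM_natl.
  have e1 : expR (11 / 172 * t) <= 1 + 11 / 161 * t.
    apply: le_trans (expR_le_inv _) _; first by lra.
    rewrite -[leLHS]mul1r ler_pdivrMr; last by lra.
    have : 0 <= t * (1 - t) by rewrite mulr_ge0 ?subr_ge0.
    by lra.
  apply: (@le_trans _ _ ((1 + 11 / 161 * t) ^+ 16)).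
    by apply: lerXn2r; rewrite ?nnegrE ?expR_ge0//; lra.
  apply: le_trans (expr_chord _ _ _) _; [by lra|by rewrite t0|].
  rewrite lerD2l ler_wpM2r//.
  by lra.
apply: (@le_trans _ _ ((1 + 2 * t) * expR (- (44 / 43 * t)))); last first.
  by rewrite ler_wpM2l//; lra.
by rewrite expRN -ler_pdivrMr ?invr_gt0 ?expR_gt0// mul1r invrK.
Qed.

(** Replaces the falling factorials produced by switching by powers of [n]. The tightest case is m =
    12, r = 4: 20736 against 23760. *)
Lemma expn_le_ffact m r : (12 <= m)%N -> (r <= 4)%N -> (m ^ r <= 2 * m ^_ r)%N.
Proof.
move=> m12 r4; have [j jE] : exists j, m = (j + 12)%N by exists (m - 12)%N; lia.
have j3 : (0 <= j * j * j)%N by [].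
case: r r4 => [|[|[|[|[|]]]]]// _;
  rewrite !ffactnS ffactn0 ?expnS expn0 ?muln1 jE.
all: rewrite -?subn1.
- by lia.
- rewrite (_ : j + 12 - 1 = j + 11)%N; [by lia|lia].
- rewrite (_ : j + 12 - 1 - 1 = j + 10)%N; last lia.
  by rewrite (_ : j + 12 - 1 = j + 11)%N; [lia|lia].
- rewrite (_ : j + 12 - 1 - 1 - 1 = j + 9)%N; last lia.
  rewrite (_ : j + 12 - 1 - 1 = j + 10)%N; last lia.
  rewrite (_ : j + 12 - 1 = j + 11)%N; last lia.
  by lia.
Qed.

(** * Chain rules for avoided events, and the lopsided local lemma *)

Section LocalLemma.

Variables (R : realFieldType) (T I : finType) (A : I -> {set T}).
Implicit Types (S U W : {set I}) (x y p : R).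

Definition avoiding S : {set T} := ~: \bigcup_(i in S) A i.

Lemma avoidingP S w : reflect (forall i, i \in S -> w \notin A i) (w \in avoiding S).
Proof.
rewrite inE; apply: (iffP idP) => [/bigcupP nS i iS|nS].
  by apply/negP => wA; apply: nS; exists i.
by apply/bigcupP => -[i iS]; apply/negP; exact: nS.
Qed.

Lemma avoiding0 : avoiding set0 = [set: T].
Proof. by rewrite /avoiding big_set0 setC0. Qed.

Lemma avoidingS S W : S \subset W -> avoiding W \subset avoiding S.
Proof.
move=> /subsetP SW; apply/subsetP => w /avoidingP aW.
by apply/avoidingP => i /SW; exact: aW.
Qed.

Lemma card_avoidingD1 S i : i \in S ->
  #|avoiding S|%:R =
  #|avoiding (S :\ i)|%:R - #|A i :&: avoiding (S :\ i)|%:R :> R.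
Proof.
move=> iS; rewrite -(cardsID (A i) (avoiding (S :\ i))) natrD setIC.
rewrite addrAC subrr add0r.
by rewrite -{1}(setD1K iS) /avoiding bigcup_setU big_set1 setCU setIC -setDE.
Qed.

(** The events outside [W] are removed one by one, each taking at most a proportion [x] of what is
    left. The hypothesis concerns only sets between [W] and [S], so that [local_lemma] can supply it
    from its own induction on the size of [S]. *)
Lemma avoiding_chain_ge x W S : 0 <= x <= 1 -> W \subset S ->
  (forall i S', W \subset S' -> S' \subset S -> i \in S -> i \notin S' ->
     #|A i :&: avoiding S'|%:R <= x * #|avoiding S'|%:R) ->
  (1 - x) ^+ #|S :\: W| * #|avoiding W|%:R <= #|avoiding S|%:R.
Proof.
move=> /andP[x0 x1]; have [m] := ubnP #|S :\: W|; elim: m S => // m IH S Sm WS step.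
have [SW0|[i]] := set_0Vmem (S :\: W).
  rewrite SW0 cards0 expr0 mul1r; suff -> : S = W by [].
  by apply/eqP; rewrite eqEsubset WS andbT -setD_eq0 SW0.
rewrite inE => /andP[iW iS].
have eD : (S :\ i) :\: W = (S :\: W) :\ i.
  by apply/setP => j; rewrite !inE andbCA.
have iSW : i \in S :\: W by rewrite inE iW.
have sW : W \subset S :\ i by rewrite subsetD1 WS.
have sS : S :\ i \subset S by exact: subD1set.
move: Sm; rewrite (cardsD1 i (S :\: W)) iSW add1n ltnS => Sm.
have := IH (S :\ i); rewrite eD => /(_ Sm sW) IHi.
rewrite (card_avoidingD1 iS) exprS -mulrA.
have := IHi (fun j S' WS' S'S jS jS' => step j S' WS' (subset_trans S'S sS)
   (subsetP sS _ jS) jS').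
have := step i _ sW sS iS; rewrite !inE eqxx => /(_ isT).
set a := _%:R; set b := #|avoiding (S :\ i)|%:R; set c := _ ^+ _ * _ => ab cb.
have : (1 - x) * c <= (1 - x) * b by rewrite ler_wpM2l// subr_ge0.
by lra.
Qed.

Lemma avoiding_chain_le y S : y <= 1 ->
  (forall i S', S' \subset S -> i \in S -> i \notin S' ->
     y * #|avoiding S'|%:R <= #|A i :&: avoiding S'|%:R) ->
  #|avoiding S|%:R <= (1 - y) ^+ #|S| * #|T|%:R.
Proof.
move=> y1; have [m] := ubnP #|S|; elim: m S => // m IH S Sm step.
have [->|[i iS]] := set_0Vmem S.
  by rewrite avoiding0 cards0 expr0 mul1r cardsT.
have sS : S :\ i \subset S by exact: subD1set.
move: Sm; rewrite (cardsD1 i S) iS add1n ltnS => Sm.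
have := IH (S :\ i) Sm (fun j S' S'S jS jS' => step j S'
   (subset_trans S'S sS) (subsetP sS _ jS) jS').
have := step i _ sS iS; rewrite !inE eqxx => /(_ isT).
rewrite (card_avoidingD1 iS) exprS -mulrA.
set a := #|A _ :&: _|%:R; set b := #|avoiding (S :\ i)|%:R; set c := _ ^+ _ * _ => ab cb.
have : (1 - y) * b <= (1 - y) * c by rewrite ler_wpM2l// subr_ge0.
by lra.
Qed.

(* Lopsided: independence is only required in the form of an upper bound on the
   probability of [A i] given that non-neighbours of [i] are avoided. *)
Lemma local_lemma (nb : rel I) U x p : 0 <= x < 1 ->
  (forall i S, i \in U -> S \subset U -> (forall j, j \in S -> ~~ nb i j) ->
     #|A i :&: avoiding S|%:R <= p * #|avoiding S|%:R) ->
  (forall i, i \in U -> p <= x * (1 - x) ^+ #|[set j in U | nb i j]|) ->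
  forall i S, i \in U -> S \subset U ->
    #|A i :&: avoiding S|%:R <= x * #|avoiding S|%:R.
Proof.
move=> /andP[x0 x1] lop px i S; have [m] := ubnP #|S|.
elim: m i S => // m IH i S Sm iU SU.
(* Lopsidedness bounds the event against the non-neighbours [W]; [chain] bounds the loss in passing
   from [W] to [S], which adds only neighbours of [i]. *)
pose W := [set j in S | ~~ nb i j].
have WS : W \subset S by apply/subsetP => j; rewrite inE => /andP[].
have chain : (1 - x) ^+ #|S :\: W| * #|avoiding W|%:R <= #|avoiding S|%:R.
  apply: avoiding_chain_ge => //; first by rewrite x0 ltW.
  move=> j S' _ S'S jS jS'; apply: IH.
  - rewrite ltnS in Sm; apply: leq_trans Sm; apply: proper_card.
    by apply/properP; split => //; exists j.
  - exact: subsetP SU _ jS.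
  - exact: subset_trans SU.
have lopW : #|A i :&: avoiding W|%:R <= p * #|avoiding W|%:R.
  apply: lop => //; first exact: subset_trans SU.
  by move=> j; rewrite inE => /andP[].
have le1 : #|A i :&: avoiding S|%:R <= #|A i :&: avoiding W|%:R :> R.
  by rewrite ler_nat; apply/subset_leq_card/setIS/avoidingS.
have pW : p * #|avoiding W|%:R <= x * (1 - x) ^+ #|S :\: W| * #|avoiding W|%:R.
  rewrite ler_wpM2r//; apply: (le_trans (px i iU)); rewrite ler_wpM2l//.
  apply: ler_wiXn2l; [by lra|by lra|].
  apply/subset_leq_card/subsetP => j; rewrite !inE => /andP[+ jS].
  by rewrite jS /= negbK (subsetP SU).
apply: (le_trans le1); apply: (le_trans lopW); apply: (le_trans pW).
by rewrite -mulrA ler_wpM2l.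
Qed.

End LocalLemma.

(** * Permutations as edge sets, and the switch that destroys an edge *)

Section Switching.

Variable n : nat.
Implicit Types (s : 'S_n) (e f g h : edge n) (F P Q : {set edge n}).
Implicit Types (S : {set {set edge n}}).

Definition graph_of s : {set edge n} := [set e : edge n | s e.1 == e.2].

Definition extending F : {set 'S_n} := [set s | F \subset graph_of s].

Lemma graph_ofP s e : reflect (s e.1 = e.2) (e \in graph_of s).
Proof. by rewrite inE; apply: eqP. Qed.

Lemma extendingP F s :
  reflect (forall e, e \in F -> s e.1 = e.2) (s \in extending F).
Proof.
rewrite inE; apply: (iffP subsetP) => sF e /sF; first by move/graph_ofP.
by move=> se; apply/graph_ofP.
Qed.

Lemma extending0 : extending set0 = [set: 'S_n].
Proof. by apply/setP => s; rewrite !inE sub0set. Qed.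

Lemma extendingU P Q : extending (P :|: Q) = extending P :&: extending Q.
Proof. by apply/setP => s; rewrite !inE subUset. Qed.

Lemma extendingS P Q : P \subset Q -> extending Q \subset extending P.
Proof.
by move=> PQ; apply/subsetP => s; rewrite !inE; exact: subset_trans.
Qed.

(** An edge is adjacent to itself, so that a conflict is among its own neighbours in the local
    lemma. *)
Definition adjacent e g : bool := (e.1 == g.1) || (e.2 == g.2).

Definition touch P Q : bool := [exists e in P, exists g in Q, adjacent e g].

Lemma touchPn P Q :
  reflect (forall e g, e \in P -> g \in Q -> e.1 != g.1 /\ e.2 != g.2)
          (~~ touch P Q).
Proof.
apply: (iffP idP) => [/exists_inPn nT e g eP gQ|nT].
  have /exists_inPn/(_ g gQ) := nT e eP.
  by rewrite /adjacent negb_or => /andP.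
apply/exists_inPn => e eP; apply/exists_inPn => g gQ.
by rewrite negb_or; apply/andP; exact: nT.
Qed.

Lemma card_extending_cols F s : s \in extending F -> #|[set e.2 | e in F]| = #|F|.
Proof.
move=> /extendingP sF; apply: card_in_imset => e g /sF eF /sF gF eg.
by rewrite (surjective_pairing e) (surjective_pairing g) eg; congr (_, _);
  apply: (@perm_inj _ s); rewrite eF gF eg.
Qed.

(* The switch [s |-> s * tperm f.2 j], with [j] not used by [F], keeps [F], destroys
   [f], and every edge it creates is adjacent to [f]. *)
Lemma switch_up F f S : f \notin F ->
  (forall Q, Q \in S -> ~~ touch [set f] Q) ->
  ((n - #|F|) * #|extending (f |: F) :&: avoiding extending S| <=
   #|extending F :&: avoiding extending S|)%N.
Proof.
move=> fF nfS; set X := _ :&: _; set Y := _ :&: _.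
have [->|[s0]] := set_0Vmem X; first by rewrite cards0 muln0.
(* [B] is the set of columns that [F] leaves free. It contains [f.2], for which the switch is the
   identity. *)
rewrite inE => /andP[s0F _]; pose B := ~: [set e.2 | e in F].
have cB : #|B| = (n - #|F|)%N.
  rewrite cardsCs setCK card_ord (@card_extending_cols _ s0)//.
  exact: subsetP (extendingS (subsetUr _ _)) _ s0F.
rewrite -cB mulnC -cardsX.
pose phi (u : 'S_n * 'I_n) := (u.1 * tperm f.2 u.2)%g.
have XP s : s \in X -> [/\ s f.1 = f.2, forall e, e \in F -> s e.1 = e.2
    & s \in avoiding extending S].
  rewrite /X extendingU -setIA !in_setI => /and3P[/extendingP sf /extendingP sF aS].
  by split=> //; apply: sf; rewrite set11.
(* The column [j] is read off as the new value at [f.1]; undoing the transposition then recovers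
   [s]. *)
have phiI : {in setX X B &, injective phi}.
  move=> [s j] [s' j'] /setXP[/XP[sf _ _] _] /setXP[/XP[s'f _ _] _] E.
  have jj' : j = j'.
    by have := congr1 (fun s : 'S_n => s f.1) E; rewrite /phi /= !permM sf s'f !tpermL.
  by move: E; rewrite /phi /= jj' => /mulIg ->.
rewrite -(card_in_imset phiI); apply/subset_leq_card/subsetP => _ /imsetP[[s j] + ->].
move=> /setXP[/XP[sf sF /avoidingP aS]]; rewrite inE => jF; rewrite inE /phi /=.
apply/andP; split.
  apply/extendingP => e eF; rewrite permM (sF _ eF) tpermD//.
    apply: contraNneq fF => fe; suff -> : f = e by [].
    rewrite (surjective_pairing e) (surjective_pairing f) fe; congr (_, _).
    by apply: (@perm_inj _ s); rewrite sf fe -sF.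
  by apply: contraNneq jF => ->; apply/imsetP; exists e.
apply/avoidingP => Q QS; apply/negP => /extendingP sQ.
have /negP := aS Q QS; apply; apply/extendingP => e eQ.
have /touchPn/(_ f e (set11 f) eQ)[fe1 fe2] := nfS Q QS.
have := sQ e eQ; rewrite permM; case: tpermP => // [se _|_ fe].
  by move: fe1; rewrite -(inj_eq (@perm_inj _ s)) sf se eqxx.
by rewrite fe eqxx in fe2.
Qed.

(** Removing the edges of [F] one at a time by [switch_up] multiplies up to the falling factorial.
    For a conflict it is n (n - 1), which gives the lopsidedness with probability [p]. *)
Lemma extending_bound F S :
  (forall Q, Q \in S -> ~~ touch F Q) ->
  (n ^_ #|F| * #|extending F :&: avoiding extending S| <= #|avoiding extending S|)%N.
Proof.
have [m] := ubnP #|F|; elim: m F => // m IH F Fm nFS.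
have [->|[f fF]] := set_0Vmem F.
  by rewrite cards0 ffactn0 mul1n extending0 setTI.
move: Fm; rewrite (cardsD1 f F) fF add1n ltnS => Fm.
rewrite ffactnSr -mulnA -[in extending F](setD1K fF).
have nT P Q : P \subset F -> Q \in S -> ~~ touch P Q.
  move=> PF QS; apply/touchPn => e g eP gQ.
  by have /touchPn/(_ e g) := nFS Q QS; apply=> //; exact: subsetP PF _ eP.
apply: leq_trans (IH (F :\ f) Fm _).
  rewrite leq_mul2l switch_up ?orbT// ?inE ?eqxx//.
  by move=> Q; apply: nT; rewrite sub1set.
by move=> Q; apply: nT; exact: subD1set.
Qed.

End Switching.

(** * Counting the conflicts that meet a given edge set *)

Section Conflicts.

Variables (R : realFieldType) (n : nat) (C : eqType) (chi : edge n -> C).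
Implicit Types (e f g h : edge n) (F P Q : {set edge n}) (a : R).

(** Edges incident to [e] are included, although they form no conflict with it; only upper bounds on
    the count are wanted. *)
Definition alike e : {set edge n} := [set h | (h != e) && (chi h == chi e)].

Lemma non_incidentE e f : non_incident e f = (e.1 != f.1) && (e.2 != f.2).
Proof.
rewrite /non_incident /ends disjoints_subset subUset !sub1set !inE.
by rewrite !negb_or andbT.
Qed.

Lemma conflictsP Q :
  reflect (exists e f, [/\ Q = [set e; f], e.1 != f.1, e.2 != f.2 & chi e = chi f])
          (Q \in conflicts chi).
Proof.
rewrite inE; apply: (iffP existsP) => [[e /existsP[f /and3P[/eqP-> + /eqP]]]|].
  by rewrite non_incidentE => /andP[]; exists e, f.
move=> [e [f [-> ef1 ef2 /eqP cef]]]; exists e; apply/existsP; exists f.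
by rewrite eqxx non_incidentE ef1 ef2 cef.
Qed.

Lemma card_conflict Q : Q \in conflicts chi -> #|Q| = 2.
Proof.
move=> /conflictsP[e [f [-> ef _ _]]]; rewrite cards2.
by case: (e =P f) ef => // ->; rewrite eqxx.
Qed.

Lemma conflict_alike Q e : Q \in conflicts chi -> e \in Q ->
  exists2 f, f \in alike e & Q = [set e; f].
Proof.
move=> /conflictsP[g [h [-> gh _ cgh]]]; rewrite !inE => /orP[]/eqP->.
  by exists h; rewrite // inE cgh eqxx andbT; apply: contraNneq gh => ->.
by exists g; rewrite 1?setUC// inE cgh eqxx andbT; apply: contraNneq gh => ->.
Qed.

Lemma card_alike_pairs a (P : {set edge n}) :
  (forall e, #|alike e|%:R <= a) ->
  #|[set u : edge n * edge n | (u.1 \in P) && (u.2 \in alike u.1)]|%:R <= #|P|%:R * a.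
Proof.
move=> alike_le; rewrite -sum1_card natr_sum.
rewrite (eq_bigl (fun u => (u.1 \in P) && (u.2 \in alike u.1))); last by move=> u; rewrite inE.
rewrite -(pair_big_dep (mem P) (fun e h => h \in alike e) (fun _ _ => 1%:R)) /=.
rewrite mulr_natl -sumr_const; apply: ler_sum => e _.
by rewrite sumr_const; exact: alike_le.
Qed.

Lemma card_adjacent f : (#|[set e | adjacent f e]| <= 2 * n)%N.
Proof.
suff -> : [set e | adjacent f e] =
    [set (f.1, j) | j in [set: 'I_n]] :|: [set (i, f.2) | i in [set: 'I_n]].
  rewrite mul2n -addnn; apply: leq_trans (leq_card_setU _ _) _.
  by apply: leq_add; apply: leq_trans (leq_imset_card _ _) _; rewrite cardsT card_ord.
apply/setP => -[i j]; rewrite !inE /adjacent /=; congr (_ || _); apply/eqP/imsetP.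
- by move=> ->; exists j; rewrite ?inE.
- by case=> ? _ [-> _].
- by move=> ->; exists i; rewrite ?inE.
- by case=> ? _ [_ ->].
Qed.

(** A touching conflict consists of an edge adjacent to [F], with at most 2 n choices for each edge
    of [F], and a partner of the same color. *)
Lemma card_touch a F : (forall e, #|alike e|%:R <= a) ->
  #|[set Q in conflicts chi | touch F Q]|%:R <= (2 * n * #|F|)%:R * a.
Proof.
move=> alike_le; pose N := \bigcup_(f in F) [set e | adjacent f e].
pose D := [set u : edge n * edge n | (u.1 \in N) && (u.2 \in alike u.1)].
(* The sign of [a] is only known once some edge exists. *)
have a0 f : f \in F -> 0 <= a by move=> _; apply: le_trans (alike_le f).
have [->|[f0 f0F]] := set_0Vmem F.
  rewrite cards0 muln0 mul0r (_ : [set _ in _ | _] = set0) ?cards0//.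
  by apply/setP => Q; rewrite !inE; apply/negP => /andP[_ /exists_inP[e]]; rewrite inE.
have cN : (#|N| <= 2 * n * #|F|)%N.
  rewrite mulnC -sum_nat_const /N.
  elim/big_ind2 : _ => [|A m B m' Am Bm'|f _]; first by rewrite cards0.
    by apply: leq_trans (leq_card_setU _ _) _; exact: leq_add.
  exact: card_adjacent.
have le1 : (#|[set Q in conflicts chi | touch F Q]| <= #|D|)%N.
  apply: leq_trans (leq_imset_card (fun u => [set u.1; u.2]) _).
  apply/subset_leq_card/subsetP => Q; rewrite inE => /andP[QU].
  move=> /exists_inP[f fF /exists_inP[g gQ fg]].
  have [h hg ->] := conflict_alike QU gQ; apply/imsetP; exists (g, h) => //.
  by rewrite inE hg andbT; apply/bigcupP; exists f => //; rewrite inE.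
apply: (@le_trans _ _ #|D|%:R); first by rewrite ler_nat.
apply: (le_trans (card_alike_pairs N alike_le)).
by rewrite ler_wpM2r ?ler_nat// (a0 f0).
Qed.

End Conflicts.

(** The union bound in counting form. *)
Lemma card_cover (R : realFieldType) (T J : finType) (X : {set T}) (D : {set J})
    (Y : J -> {set T}) (b : R) :
  (forall s, s \in X -> exists2 j, j \in D & s \in Y j) ->
  (forall j, j \in D -> #|Y j|%:R <= b) -> #|X|%:R <= #|D|%:R * b.
Proof.
move=> XY Yb; apply: (@le_trans _ _ (\sum_(j in D) #|Y j|)%:R).
  rewrite ler_nat; apply: (@leq_trans #|\bigcup_(j in D) Y j|).
    by apply/subset_leq_card/subsetP => s /XY[j jD sY]; apply/bigcupP; exists j.
  elim/big_ind2 : _ => [|A m B m' Am Bm'|//]; first by rewrite cards0.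
  by apply: leq_trans (leq_card_setU _ _) _; exact: leq_add.
by rewrite natr_sum mulr_natl -sumr_const; exact: ler_sum.
Qed.

(** * The switch that forces an edge, and the ways in which it fails *)

Section SwitchDown.

Variables (n : nat) (C : eqType) (chi : edge n -> C).
Variables (F : {set edge n}) (f : edge n) (S : {set {set edge n}}).
Hypothesis Ff : forall e, e \in F -> e.1 != f.1 /\ e.2 != f.2.
Hypothesis SU : S \subset conflicts chi.
Hypothesis FS : forall h, h \in F -> [set f; h] \notin S.
Implicit Types (s : 'S_n) (g h e : edge n).

(* The switch that forces [f] into [s]. *)
Let phi s : 'S_n := (s * tperm (s f.1) f.2)%g.

Definition bad_switch : {set 'S_n} :=
  [set s in extending F :&: avoiding (@extending n) S | phi s \notin avoiding (@extending n) S].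

(* If [s] extends [F] and [g] is the other edge created by [phi s], then
   [detour g] is contained in [graph_of s]. *)
Definition detour g : {set edge n} := (g.1, f.2) |: ((f.1, g.2) |: F).

Lemma switch_down :
  (#|extending F :&: avoiding (@extending n) S| <=
   (n - #|F|) * #|extending (f |: F) :&: avoiding (@extending n) S| + #|bad_switch|)%N.
Proof.
set X := _ :&: _; set Z := _ :&: avoiding _ _.
have [->|[s0]] := set_0Vmem X; first by rewrite cards0.
rewrite inE => /andP[s0F _]; pose B := ~: [set e.2 | e in F].
have cB : #|B| = (n - #|F|)%N.
  by rewrite cardsCs setCK card_ord (card_extending_cols s0F).
rewrite -(cardsID bad_switch X) addnC leq_add//; last exact/subset_leq_card/subsetIr.
rewrite -cB mulnC -cardsX.
apply: leq_trans (leq_imset_card (fun u : 'S_n * 'I_n => u.1 * tperm f.2 u.2)%g _).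
apply/subset_leq_card/subsetP => s /setDP[sX]; rewrite inE sX /= negbK => aphi.
move: sX; rewrite inE => /andP[/extendingP sF _].
apply/imsetP; exists (phi s, s f.1); last by rewrite /= -mulgA tpermC tperm2 mulg1.
apply/setXP; split; last first.
  rewrite inE; apply/imsetP => -[e eF] /= se; have [+ _] := Ff eF.
  by rewrite -(inj_eq (@perm_inj _ s)) se sF// eqxx.
rewrite inE aphi andbT; apply/extendingP => e; rewrite !inE => /orP[/eqP->|eF].
  by rewrite permM tpermL.
have [ef1 ef2] := Ff eF; rewrite permM tpermD; [exact: sF| |by rewrite sF// eq_sym].
by rewrite (inj_eq (@perm_inj _ s)) eq_sym.
Qed.

(** The switch changes [s] only in the row [f.1], which receives [f], and in the row formerly sent
    to [f.2], which receives the column [s f.1]. *)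
Lemma graph_phi s e : e \in graph_of (phi s) -> e \notin graph_of s ->
  e = f \/ [/\ s e.1 = f.2, s f.1 = e.2 & s f.1 != f.2].
Proof.
move=> /graph_ofP; rewrite permM inE; case: tpermP => [/perm_inj e1 e2|e1 e2|_ _ ->].
- by left; rewrite (surjective_pairing e) (surjective_pairing f) e1 e2.
- by rewrite -e2 -e1 eq_sym => ?; right.
- by rewrite eqxx.
Qed.

(** The two removed edges meet [f] and so lie outside [F]; they differ because the switch is not the
    identity. *)
Lemma detourP s g : s \in extending F ->
  s g.1 = f.2 -> s f.1 = g.2 -> s f.1 != f.2 ->
  s \in extending (detour g) /\ #|detour g| = (#|F| + 2)%N.
Proof.
move=> /extendingP sF s1 s2 s12; split.
  by apply/extendingP => e; rewrite !inE => /or3P[/eqP->|/eqP->|/sF].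
rewrite /detour !cardsU1 !inE !negb_or.
have -> : (g.1, f.2) != (f.1, g.2) by rewrite -s2 xpair_eqE negb_and [f.2 == _]eq_sym s12 orbT.
have -> : (g.1, f.2) \notin F by apply/negP => /Ff[_]; rewrite eqxx.
have -> : (f.1, g.2) \notin F by apply/negP => /Ff[]; rewrite eqxx.
by rewrite /= !add1n addn2.
Qed.

(** A failure creates a conflict in [S], which contains a new edge. Either this is [f] and the
    partner was already in [s], or it is the other new edge [g] with partner in [f |: F], or it is
    [g] with an old partner elsewhere. The exact sizes tell how many powers of 1 / n each case is
    worth. *)
Lemma bad_switchP s : s \in bad_switch ->
  [\/ exists2 h, h \in alike chi f &
        s \in extending (h |: F) /\ #|h |: F| = (#|F| + 1)%N,
      exists g h, [/\ h \in f |: F, g \in alike chi h,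
        s \in extending (detour g) & #|detour g| = (#|F| + 2)%N] |
      exists g h, [/\ h \in alike chi g,
        s \in extending (h |: detour g) & #|h |: detour g| = (#|F| + 3)%N]].
Proof.
rewrite inE => /andP[]; rewrite inE => /andP[sF /avoidingP aS].
have alike_sym g h : g \in alike chi h -> h \in alike chi g.
  by rewrite !inE eq_sym [chi _ == _]eq_sym.
have extU h P : s \in extending P -> h \in graph_of s -> s \in extending (h |: P).
  by move=> sP sh; rewrite extendingU !inE sub1set sh; move: sP; rewrite inE.
rewrite inE negbK => /bigcupP[Q QS]; rewrite inE => /subsetP Qphi.
have := aS Q QS; rewrite inE => /subsetPn[e eQ es].
have [h eh QE] := conflict_alike (subsetP SU _ QS) eQ.
have hphi : h \in graph_of (phi s) by apply: Qphi; rewrite QE !inE eqxx orbT.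
have hne : h != e by move: eh; rewrite inE => /andP[].
have [ef|[e1 e2 e12]] := graph_phi (Qphi _ eQ) es.
  have hF : h \notin F by apply/negP => /FS; rewrite -ef -QE QS.
  have [hs|hs] := boolP (h \in graph_of s).
    apply: Or31; exists h; first by rewrite -ef.
    by split; [exact: extU|rewrite cardsU1 hF addnC].
  have [hf|[h1 h2 h12]] := graph_phi hphi hs; first by rewrite hf -ef eqxx in hne.
  have [sd cd] := detourP sF h1 h2 h12.
  by apply: Or32; exists h, f; split => //; [rewrite setU11|rewrite -ef].
have [sd cd] := detourP sF e1 e2 e12.
have [hF|hF] := boolP (h \in f |: F).
  by apply: Or32; exists e, h; split => //; exact: alike_sym.
move: hF; rewrite !inE negb_or => /andP[hf hF].
have hs : h \in graph_of s.
  apply/negPn/negP => /(graph_phi hphi)[/eqP|[h1 h2 _]]; first exact/negP.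
  move: hne; rewrite (surjective_pairing e) (surjective_pairing h) -e2 -h2.
  by rewrite -(@perm_inj _ s h.1 e.1) ?eqxx// h1.
apply: Or33; exists e, h; split => //; first exact: extU.
rewrite cardsU1 cd !inE (negPf hF) orbF negb_or.
(* [h] survives the switch, while the two edges of [detour] outside [F] are destroyed by it. *)
have -> : h != (e.1, f.2).
  apply: contraNneq e12 => hE; move: hphi; rewrite hE => /graph_ofP /=.
  by rewrite permM e1 tpermR => ->.
have -> : h != (f.1, e.2).
  apply: contraNneq e12 => hE; move: hphi; rewrite hE => /graph_ofP /=.
  by rewrite permM tpermL -e2 => ->.
by rewrite addnC -addnA.
Qed.

End SwitchDown.

(** * Two-sided bounds on the number of permutations avoiding all conflicts *)

Section Bounds.

Variables (R : realType) (n : nat) (C : eqType) (chi : edge n -> C) (k : R).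
Hypotheses (k12 : 12 <= k) (kn : k <= n%:R).
Hypothesis alike_le : forall e, #|alike chi e|%:R <= (n%:R - 1) / k.
Implicit Types (e f g h : edge n) (F P Q : {set edge n}).
Implicit Types (S : {set {set edge n}}).

Let U := conflicts chi.
Let p : R := (n%:R * (n%:R - 1))^-1.
Let w : R := (1 + 24 / k) * p.

Let k_gt0 : 0 < k. Proof. by move: k12; lra. Qed.

Let n_ge12 : 12 <= n%:R :> R. Proof. exact: le_trans kn. Qed.

Let n1_gt0 : 0 < n%:R - 1 :> R. Proof. by move: n_ge12; lra. Qed.

Let n_gt0 : 0 < n%:R :> R. Proof. by move: n_ge12; lra. Qed.

Let p_gt0 : 0 < p. Proof. by rewrite invr_gt0 mulr_gt0. Qed.

Let p_le : p <= (11 * k)^-1.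
Proof.
rewrite lef_pV2 ?posrE ?mulr_gt0//.
rewrite mulrC; apply: ler_pM => //; last by move: n_ge12; lra.
exact: ltW.
Qed.

Let p_le132 : p <= 132^-1.
Proof.
apply: (le_trans p_le); rewrite lef_pV2 ?posrE ?mulr_gt0//.
by move: k12; lra.
Qed.

Let degree_le F :
  #|[set Q in U | touch F Q]|%:R * p <= 2 * #|F|%:R / k.
Proof.
apply: (@le_trans _ _ ((2 * n * #|F|)%:R * ((n%:R - 1) / k) * p)).
  by rewrite ler_wpM2r ?(ltW p_gt0)//; exact: card_touch.
rewrite le_eqVlt; apply/orP; left; apply/eqP; rewrite !natrM /p.
by field; rewrite !gt_eqF.
Qed.

Let kinv_le : 24 / k <= 2.
Proof. by rewrite ler_pdivrMr//; move: k12; lra. Qed.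

Let kinv_ge0 : 0 <= 24 / k. Proof. by rewrite divr_ge0// ltW. Qed.

Let w_ge0 : 0 <= w.
Proof. by rewrite mulr_ge0 ?(ltW p_gt0)// addr_ge0. Qed.

Let w_le : w <= 44^-1.
Proof.
have : (1 + 24 / k) * p <= 3 * 132^-1.
  apply: ler_pM; [by rewrite addr_ge0|exact: ltW p_gt0| |exact: p_le132].
  by move: kinv_le; lra.
by rewrite -/w; lra.
Qed.

Let nat_n1 : (0 < n)%N. Proof. by move: n_gt0; rewrite ltr0n. Qed.

(** The local lemma with neighbourhood [touch] and weight [w]: [extending_bound] gives the
    lopsidedness, and [degree_le] with |Q| = 2 gives the degree bound 4 / k. *)
Lemma conflict_le S Q : Q \in U -> S \subset U ->
  #|extending Q :&: avoiding (@extending n) S|%:R <=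
  w * #|avoiding (@extending n) S|%:R.
Proof.
apply: (local_lemma (nb := @touch n) (p := p)).
- by rewrite w_ge0/=; move: w_le; lra.
- move=> {S}Q S QU _ nT; rewrite mulrC ler_pdivlMr ?mulr_gt0//.
  have := extending_bound nT; rewrite (card_conflict QU) ffactnS ffactn1.
  rewrite -(ler_nat R) !natrM -subn1 natrB// => le1.
  by rewrite mulrC.
- move=> {S}Q QU; apply: local_lemma_weight => //.
    by rewrite p_le132 (ltW p_gt0).
  apply: (le_trans (degree_le Q)); rewrite (card_conflict QU).
  by rewrite -natrM.
Qed.

Lemma avoiding_le S S' : S' \subset S -> S \subset U ->
  (1 - w) ^+ #|S :\: S'| * #|avoiding (@extending n) S'|%:R <=
  #|avoiding (@extending n) S|%:R.
Proof.
move=> S'S SU; apply: avoiding_chain_ge => //.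
  by rewrite w_ge0/=; move: w_le; lra.
move=> Q W _ WS QS _; apply: conflict_le; first exact: subsetP SU _ QS.
exact: subset_trans SU.
Qed.

Lemma avoiding_ge :
  expR (- (1 + 25 / k) * (#|U|%:R * p)) * n`!%:R <= #|avoiding (@extending n) U|%:R.
Proof.
have := avoiding_le (sub0set U) (subxx U).
rewrite setD0 avoiding0 cardsT card_Sn.
apply: le_trans; rewrite ler_wpM2r//.
have w1 : w < 1 by move: w_le; lra.
apply: (@le_trans _ _ (expR (- (w / (1 - w))) ^+ #|U|)); last first.
  by apply: lerXn2r; rewrite ?nnegrE ?expR_ge0 ?expR_ge_inv//; lra.
rewrite -expRM_natl ler_expR mulrN mulNr lerN2 [leRHS]mulrC -[leRHS]mulrA ler_wpM2l//.
rewrite ler_pdivrMr ?subr_gt0// mulrC.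
have wp : w = p + p * (24 / k) by rewrite /w; ring.
(* The step from 24 to 25 pays for the denominator [1 - w]: [w] is at most 3 / (11 k), and 3/11
   times 1 + 25/12 is below 1. *)
have : p * w * (1 + 25 / k) <= p * (1 / k).
  rewrite -mulrA ler_wpM2l ?(ltW p_gt0)//.
  apply: (@le_trans _ _ ((3 * (11 * k)^-1) * (1 + 25 / 12))).
    apply: ler_pM => //.
    - by rewrite addr_ge0// divr_ge0// ltW.
    - apply: ler_pM; [by rewrite addr_ge0|exact: ltW p_gt0| |exact: p_le].
      by move: kinv_le; lra.
    - rewrite lerD2l ler_wpM2l// lef_pV2 ?posrE//.
  rewrite invfM; have : 0 <= k^-1 by rewrite invr_ge0 ltW.
  by lra.
by rewrite wp; lra.
Qed.

(** Bernoulli's inequality; 8 / k is the bound of [degree_le] for four edges. *)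
Let half_le (D : nat) : 32 <= k -> D%:R * p <= 8 / k -> 2^-1 <= (1 - w) ^+ D.
Proof.
move=> k32 Dp.
have Dw : D%:R * w <= 2^-1.
  have -> : D%:R * w = (1 + 24 / k) * (D%:R * p) by rewrite /w; ring.
  apply: (@le_trans _ _ ((1 + 24 / 32) * (8 / 32))); last by lra.
  have kV : k^-1 <= 32^-1 by rewrite lef_pV2 ?posrE.
  apply: ler_pM; [by rewrite addr_ge0|by rewrite mulr_ge0 ?(ltW p_gt0)| |].
    by move: kV; lra.
  by apply: (le_trans Dp); move: kV; lra.
have bern : 1 - D%:R * w <= (1 - w) ^+ D.
  elim: D {Dp Dw} => [|D IH]; first by rewrite expr0 mul0r subr0.
  rewrite exprS; have w1 : 0 <= 1 - w by move: w_le; lra.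
  apply: le_trans (ler_wpM2l w1 IH).
  have : 0 <= D%:R * w * w by rewrite mulr_ge0// mulr_ge0.
  by rewrite -natr1; lra.
by apply: le_trans bern; move: Dw; lra.
Qed.

(** Conflicts touching [F] are dropped, so that [extending_bound] applies, and then restored by
    [avoiding_le]. The restoring costs a factor 2 and the falling factorial another, hence 4. *)
Lemma extending_le F S : 32 <= k -> (#|F| <= 4)%N -> S \subset U ->
  #|extending F :&: avoiding (@extending n) S|%:R <=
  4 / n%:R ^+ #|F| * #|avoiding (@extending n) S|%:R :> R.
Proof.
move=> k32 F4 SU; pose S' := [set Q in S | ~~ touch F Q].
have S'S : S' \subset S by apply/subsetP => Q; rewrite inE => /andP[].
have le1 : #|extending F :&: avoiding (@extending n) S|%:R <=
    #|extending F :&: avoiding (@extending n) S'|%:R :> R.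
  by rewrite ler_nat; apply/subset_leq_card/setIS/avoidingS.
have le2 : #|extending F :&: avoiding (@extending n) S'|%:R <=
    2 / n%:R ^+ #|F| * #|avoiding (@extending n) S'|%:R :> R.
  rewrite mulrAC ler_pdivlMr ?exprn_gt0//.
  have nT Q : Q \in S' -> ~~ touch F Q by rewrite inE => /andP[].
  have := extending_bound nT; rewrite -(ler_nat R) natrM => le2.
  apply: (@le_trans _ _ (2 * ((n ^_ #|F|)%:R *
      #|extending F :&: avoiding (@extending n) S'|%:R))); last by rewrite ler_wpM2l.
  rewrite mulrC mulrA ler_wpM2r// -natrM -natrX ler_nat.
  by apply: expn_le_ffact; rewrite // -(ler_nat R).
have le3 : #|avoiding (@extending n) S'|%:R <= 2 * #|avoiding (@extending n) S|%:R :> R.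
  have := avoiding_le S'S SU; set D := #|_|; set a := _%:R; set b := _%:R => le3.
  have Dp : D%:R * p <= 8 / k.
    apply: le_trans (_ : #|[set Q in U | touch F Q]|%:R * p <= _).
      rewrite ler_wpM2r ?(ltW p_gt0)// ler_nat; apply/subset_leq_card/subsetP => Q.
      rewrite !inE => /andP[+ QS]; rewrite QS/= negbK => ->.
      by have := subsetP SU _ QS; rewrite inE => ->.
    apply: (le_trans (degree_le F)); rewrite ler_wpM2r ?invr_ge0 ?(ltW k_gt0)//.
    by rewrite -natrM ler_nat (@leq_pmul2l 2 _ 4).
  have : 2^-1 * a <= (1 - w) ^+ D * a by rewrite ler_wpM2r// half_le.
  by move: le3; move: (_ ^+ D * a) => c; lra.
apply: (le_trans le1); apply: (le_trans le2).
apply: (le_trans (ler_wpM2l _ le3)); first by rewrite divr_ge0// exprn_ge0// ltW.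
by rewrite mulrA [2 / _ * 2]mulrAC -natrM.
Qed.

(** A union bound over the three cases of [bad_switchP], which contribute 4, 8 and 4 to the constant
    16. *)
Lemma bad_switch_le F f S : 32 <= k -> (#|F| <= 1)%N ->
  (forall e, e \in F -> e.1 != f.1 /\ e.2 != f.2) -> S \subset U ->
  (forall h, h \in F -> [set f; h] \notin S) ->
  #|bad_switch F f S|%:R <=
  16 / k / n%:R ^+ #|F| * #|avoiding (@extending n) S|%:R :> R.
Proof.
move=> k32 F1 Ff SU FS; set V := #|avoiding _ S|%:R.
pose a : R := (n%:R - 1) / k; pose q : R := n%:R^-1; pose z : R := (n%:R ^+ #|F|)^-1.
pose Y P := extending P :&: avoiding (@extending n) S.
have Y_le r P : #|P| = (#|F| + r)%N -> (r <= 3)%N -> #|Y P|%:R <= 4 * z * q ^+ r * V.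
  move=> Pr r3; apply: (le_trans (extending_le k32 _ SU)).
    by rewrite Pr; exact: leq_add F1 r3.
  by rewrite Pr exprD invfM exprVn mulrA.
have a_ge0 : 0 <= a by rewrite divr_ge0 ?ltW.
have q_gt0 : 0 < q by rewrite invr_gt0.
have z_ge0 : 0 <= z by rewrite invr_ge0 exprn_ge0 ?ltW.
have zV : 0 <= z * V by rewrite mulr_ge0.
have nq : n%:R * q = 1 by rewrite mulfV ?gt_eqF.
have aq : a * q <= k^-1.
  rewrite /a mulrAC mulrBl nq mul1r -[leRHS]mul1r ler_wpM2r ?invr_ge0 ?(ltW k_gt0)//.
  by rewrite lerBlDr lerDl ltW.
have q1 : q <= 1 by rewrite invf_le1//; move: n_ge12; lra.
(* The index sets keep only configurations of the exact size, to which [Y_le] applies. *)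
pose D1 := [set h in alike chi f | #|h |: F| == (#|F| + 1)%N].
pose A2 := [set u : edge n * edge n | (u.1 \in f |: F) && (u.2 \in alike chi u.1)].
pose D2 := [set u in A2 | #|detour F f u.2| == (#|F| + 2)%N].
pose A3 := [set u : edge n * edge n | (u.1 \in [set: edge n]) && (u.2 \in alike chi u.1)].
pose D3 := [set u in A3 | #|u.2 |: detour F f u.1| == (#|F| + 3)%N].
pose X1 := \bigcup_(h in D1) Y (h |: F).
pose X2 := \bigcup_(u in D2) Y (detour F f u.2).
pose X3 := \bigcup_(u in D3) Y (u.2 |: detour F f u.1).
have cX1 : #|X1|%:R <= 4 * (a * q) * (z * V).
  apply: (le_trans (@card_cover R _ _ X1 D1 _ (4 * z * q * V) _ _)).
  - by move=> s /bigcupP[h hD sY]; exists h; last exact: sY.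
  - by move=> h; rewrite inE => /andP[_ /eqP hF]; exact: (Y_le 1).
  - have : #|D1|%:R <= a.
      apply: le_trans (alike_le f); rewrite ler_nat.
      by apply/subset_leq_card/subsetP => h; rewrite inE => /andP[].
    have : 0 <= 4 * z * q * V by rewrite !mulr_ge0// ltW.
    by move=> X0 /(ler_wpM2r X0); lra.
have cX2 : #|X2|%:R <= 8 * (a * q) * q * (z * V).
  apply: (le_trans (@card_cover R _ _ X2 D2 _ (4 * z * q ^+ 2 * V) _ _)).
  - by move=> s /bigcupP[h hD sY]; exists h; last exact: sY.
  - by move=> h; rewrite inE => /andP[_ /eqP hF]; apply: Y_le.
  - have : #|D2|%:R <= 2 * a.
      apply: (@le_trans _ _ (#|f |: F|%:R * a)).
        apply: le_trans (card_alike_pairs (f |: F) alike_le); rewrite ler_nat.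
        by apply/subset_leq_card/subsetP => u /setIdP[].
      rewrite ler_wpM2r// ler_nat cardsU1.
      by apply: (@leq_add _ _ 1 1) => //; case: (_ \notin _).
    have : 0 <= 4 * z * q ^+ 2 * V by rewrite !mulr_ge0 ?exprn_ge0// ltW.
    by move=> X0 /(ler_wpM2r X0); lra.
have cX3 : #|X3|%:R <= 4 * (a * q) * (z * V).
  apply: (le_trans (@card_cover R _ _ X3 D3 _ (4 * z * q ^+ 3 * V) _ _)).
  - by move=> s /bigcupP[h hD sY]; exists h; last exact: sY.
  - by move=> h; rewrite inE => /andP[_ /eqP hF]; apply: Y_le.
  (* The n^2 choices of [g] use up two of the three factors [q]. *)
  - have : #|D3|%:R <= n%:R ^+ 2 * a.
      apply: (@le_trans _ _ (#|[set: edge n]|%:R * a)).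
        apply: le_trans (card_alike_pairs [set: edge n] alike_le); rewrite ler_nat.
        by apply/subset_leq_card/subsetP => u /setIdP[].
      by rewrite cardsT card_prod card_ord natrM -expr2.
    have : 0 <= 4 * z * q ^+ 3 * V by rewrite !mulr_ge0 ?exprn_ge0// ltW.
    move=> X0 /(ler_wpM2r X0) => le3; apply: (le_trans le3).
    rewrite le_eqVlt; apply/orP; left; apply/eqP.
    transitivity (4 * (a * q) * (z * V) * (n%:R * q) ^+ 2); first by ring.
    by rewrite nq expr1n mulr1.
have cB : #|bad_switch F f S|%:R <= #|X1|%:R + #|X2|%:R + #|X3|%:R :> R.
  rewrite -!natrD ler_nat; apply: (@leq_trans #|X1 :|: X2 :|: X3|); last first.
    apply: leq_trans (leq_card_setU _ _) _; rewrite leq_add2r.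
    exact: leq_card_setU.
  apply/subset_leq_card/subsetP => s sB.
  have sV : s \in avoiding (@extending n) S.
    by move: sB; rewrite inE => /andP[+ _]; rewrite inE => /andP[].
  rewrite !inE -orbA; apply/or3P.
  case: (bad_switchP Ff SU FS sB) => [[h hf [sh ch]]|[g [h [hf gh sg cg]]]|[g [h [hg sg cg]]]].
  - apply: Or31; apply/bigcupP; exists h; first by rewrite inE hf ch eqxx.
    by rewrite inE sh.
  - apply: Or32; apply/bigcupP; exists (h, g); last by rewrite inE sg.
    by rewrite !inE /= cg eqxx andbT; move: hf gh; rewrite !inE => -> ->.
  - apply: Or33; apply/bigcupP; exists (g, h); last by rewrite inE sg.
    by rewrite !inE /= cg eqxx andbT; move: hg; rewrite !inE => ->.
have -> : 16 / k / n%:R ^+ #|F| * V = 16 * (k^-1 * (z * V)) by rewrite /z !mulrA.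
have aqzV : a * q * (z * V) <= k^-1 * (z * V) by rewrite ler_wpM2r.
have : 8 * (a * q) * q * (z * V) <= 8 * (a * q * (z * V)).
  have : 0 <= a * q * (z * V) by rewrite mulr_ge0// mulr_ge0// ltW.
  have -> : 8 * (a * q) * q * (z * V) = 8 * (a * q * (z * V)) * q by ring.
  by move=> X0; rewrite ler_piMr// mulr_ge0.
move: cB cX1 cX2 cX3 aqzV; rewrite -!mulrA; lra.
Qed.

(** First [e] is forced into a permutation avoiding [S], then [f] into one that also contains [e].
    Each switch loses 16 / k, hence 32. *)
Lemma conflict_ge Q S : 32 <= k -> Q \in U -> S \subset U -> Q \notin S ->
  (1 - 32 / k) * p * #|avoiding (@extending n) S|%:R <=
  #|extending Q :&: avoiding (@extending n) S|%:R.
Proof.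
move=> k32 /conflictsP[e [f [-> ef1 ef2 _]]] SU QS.
set V := #|avoiding _ S|%:R; set X := #|_|%:R.
have e0 : forall g, g \in set0 -> g.1 != e.1 /\ g.2 != e.2 by move=> g; rewrite inE.
have S0 : forall h, h \in set0 -> [set e; h] \notin S by move=> h; rewrite inE.
have := bad_switch_le k32 _ e0 SU S0; rewrite cards0 => /(_ isT) bad1.
have := switch_down S e0; rewrite cards0 subn0 setU0 extending0 setTI.
rewrite -(ler_nat R) natrD natrM -/V.
set E := #|extending [set e] :&: _|%:R => down1.
have e1 g : g \in [set e] -> g.1 != f.1 /\ g.2 != f.2 by rewrite inE => /eqP->.
(* This is where [Q \notin S] enters: forcing [f] next to [e] completes [Q] itself. *)
have S1 h : h \in [set e] -> [set f; h] \notin S by rewrite inE setUC => /eqP->.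
have := bad_switch_le k32 _ e1 SU S1; rewrite cards1 => /(_ isT) bad2.
have := switch_down S e1; rewrite cards1.
rewrite -(ler_nat R) natrD natrM natrB// setUC -/X -/E => down2.
have n_E : n%:R * E <= n%:R * ((n%:R - 1) * X) + 16 / k * V.
  apply: (@le_trans _ _ (n%:R * ((n%:R - 1) * X + 16 / k / n%:R ^+ 1 * V))).
    by rewrite ler_wpM2l ?(ltW n_gt0)//; apply: (le_trans down2); rewrite lerD2l.
  rewrite mulrDr lerD2l expr1 le_eqVlt; apply/orP; left; apply/eqP.
  by field; rewrite !gt_eqF.
move: bad1; rewrite expr0 divr1 => bad1.
rewrite [_ * p]mulrC -mulrA /p mulrC ler_pdivrMr ?mulr_gt0// mulrC.
have := le_trans down1 (lerD (lexx _) bad1).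
by move: n_E; rewrite -/V; lra.
Qed.

Lemma avoiding_ub : 32 <= k ->
  #|avoiding (@extending n) U|%:R <= expR (- (1 - 32 / k) * (#|U|%:R * p)) * n`!%:R.
Proof.
move=> k32; set y := (1 - 32 / k) * p.
have k1 : 0 <= 32 / k <= 1.
  by rewrite divr_ge0 ?(ltW k_gt0)//= ler_pdivrMr// mul1r.
have y1 : y <= 1.
  apply: (@le_trans _ _ (1 * 1)); last by rewrite mulr1.
  by apply: ler_pM => //; rewrite ?(ltW p_gt0)//; move: k1 p_le132; lra.
have := @avoiding_chain_le R _ _ (@extending n) y U y1.
rewrite card_Sn => /(_ _)/le_trans; apply.
  by move=> Q S SU QU QS; exact: conflict_ge.
rewrite ler_wpM2r//; apply: (@le_trans _ _ (expR (- y) ^+ #|U|)).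
  by apply: lerXn2r; rewrite ?nnegrE ?expR_ge0 ?subr_ge0 ?expR_ge1Dx.
rewrite -expRM_natl ler_expR /y le_eqVlt; apply/orP; left; apply/eqP.
by ring.
Qed.

End Bounds.

(** * Perfect matchings as graphs of permutations *)

Section PerfectMatchings.

Variable n : nat.

Lemma graph_of_inj : injective (@graph_of n).
Proof.
move=> s s' ss'; apply/permP => i.
have : (i, s i) \in graph_of s by rewrite inE.
by rewrite ss' => /graph_ofP.
Qed.

Lemma perfect_matchingP (M : {set edge n}) :
  reflect ((forall e f, e \in M -> f \in M -> e != f -> e.1 != f.1 /\ e.2 != f.2) /\
           (forall i, exists j, (i, j) \in M) /\ (forall j, exists i, (i, j) \in M))
          (perfect_matching M).
Proof.
apply: (iffP andP) => [[/forall_inP indep /forallP cover]|[indep [left_cover right_cover]]].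
  split=> [e f eM fM ef|].
    have /forall_inP/(_ f fM) := indep e eM.
    by rewrite ef non_incidentE => /andP.
  split=> [i|j].
    have /exists_inP[[i' j] eM] := cover (inl i).
    by rewrite !inE => /orP[/eqP[->]|//]; exists j.
  have /exists_inP[[i j'] eM] := cover (inr j).
  by rewrite !inE => /orP[//|/eqP[->]]; exists i.
split.
  apply/forall_inP => e eM; apply/forall_inP => f fM; apply/implyP => ef.
  by rewrite non_incidentE; apply/andP; exact: indep.
apply/forallP => -[i|j]; apply/exists_inP.
  by have [j ijM] := left_cover i; exists (i, j); rewrite // !inE eqxx.
by have [i ijM] := right_cover j; exists (i, j); rewrite // !inE eqxx orbT.
Qed.

Lemma perfect_matchingsE :
  perfect_matchings n = [set graph_of s | s in [set: 'S_n]].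
Proof.
apply/setP => M; rewrite inE; apply/idP/imsetP => [/perfect_matchingP|[s _ ->]].
  move=> [indep [left_cover _]].
  have row_uniq i j j' : (i, j) \in M -> (i, j') \in M -> j = j'.
    move=> ij ij'; apply/eqP/negPn/negP => jj'.
    have [|] := indep _ _ ij ij'; last by rewrite eqxx.
    by apply: contraNneq jj' => -[->].
  have col_uniq i i' j : (i, j) \in M -> (i', j) \in M -> i = i'.
    move=> ij ij'; apply/eqP/negPn/negP => ii'.
    have [|_] := indep _ _ ij ij'; last by rewrite eqxx.
    by apply: contraNneq ii' => -[->].
  pose t i := xchoose (left_cover i).
  have tM i : (i, t i) \in M by exact: (xchooseP (left_cover i)).
  have t_inj : injective t.
    by move=> i i' tt; apply: (col_uniq _ _ (t i)); rewrite // tt.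
  exists (perm t_inj); rewrite ?inE//; apply/setP => -[i j].
  rewrite inE permE /=; apply/idP/eqP => [ijM|<-//].
  exact: row_uniq (tM i) ijM.
apply/perfect_matchingP; split=> [e f|].
  move=> /graph_ofP se /graph_ofP sf ef.
  have e1f1 : e.1 != f.1.
    apply: contraNneq ef => e1f1.
    by rewrite (surjective_pairing e) (surjective_pairing f) -se -sf e1f1.
  by rewrite -se -sf (inj_eq (@perm_inj _ s)).
split=> [i|j]; first by exists (s i); rewrite inE.
by exists (s^-1%g j); rewrite inE /= permKV.
Qed.

(** Distinct edges of a permutation are non-incident, so two of them with the same color always form
    a conflict. *)
Lemma rainbow_graph_of (C : eqType) (chi : edge n -> C) (s : 'S_n) :
  rainbow chi (graph_of s) = (s \in avoiding (@extending n) (conflicts chi)).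
Proof.
apply/idP/avoidingP => [/forall_inP rb Q /conflictsP[e [f [-> ef1 _ cef]]]|aU].
  apply/negP; rewrite inE subUset !sub1set => /andP[es fs].
  have /forall_inP/(_ f fs) := rb e es; rewrite cef eqxx implybF negbK => /eqP ef.
  by rewrite ef eqxx in ef1.
apply/forall_inP => e es; apply/forall_inP => f fs; apply/implyP => ef.
apply/negP => /eqP cef.
have e1f1 : e.1 != f.1.
  apply: contraNneq ef => e1f1.
  rewrite (surjective_pairing e) (surjective_pairing f).
  by move/graph_ofP: es => <-; move/graph_ofP: fs => <-; rewrite e1f1.
have /aU : [set e; f] \in conflicts chi.
  apply/conflictsP; exists e, f; split=> //.
  move/graph_ofP: es => <-; move/graph_ofP: fs => <-.
  by rewrite (inj_eq (@perm_inj _ s)).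
by rewrite inE subUset !sub1set es fs.
Qed.

Lemma prob_rainbowE (R : realType) (C : eqType) (chi : edge n -> C) :
  prob_rainbow chi R =
  #|avoiding (@extending n) (conflicts chi)|%:R / n`!%:R.
Proof.
rewrite /prob_rainbow perfect_matchingsE (card_imset _ graph_of_inj) cardsT card_Sn.
congr (_%:R / _); rewrite -(card_imset _ graph_of_inj); congr #|pred_of_set _|.
apply/setP => M; rewrite inE; apply/andP/imsetP => [[/imsetP[s _ ->]]|[s aU ->]].
  by rewrite rainbow_graph_of; exists s.
by rewrite rainbow_graph_of; split=> //; apply/imsetP; exists s.
Qed.

End PerfectMatchings.

(** * Explicit bounds for the rainbow probability and for [mu] *)

Section ProbabilityBounds.

Variables (R : realType) (n : nat) (C : eqType) (chi : edge n -> C) (k : R).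
Hypothesis chi_k : color_bounded chi k.

(** A color that is used at all appears at least once, so n / k is at least 1. *)
Lemma color_bounded_le : (0 < n)%N -> 0 < k -> k <= n%:R.
Proof.
move=> n0 k0; pose i := Ordinal n0.
have := chi_k (chi (i, i)); rewrite ler_pdivlMr//; apply: le_trans.
rewrite ler_peMl ?(ltW k0)// ler1n card_gt0.
by apply/set0Pn; exists (i, i); rewrite inE.
Qed.

(** Leaving out [e] itself gives n / k - 1, at most (n - 1) / k since [k >= 1]; the factor n - 1
    later cancels against [p]. *)
Lemma color_bounded_alike e : 1 <= k -> #|alike chi e|%:R <= (n%:R - 1) / k.
Proof.
move=> k1; have k0 : 0 < k by lra.
have := chi_k (chi e); rewrite (cardsD1 e) inE eqxx natrD mulr1n.
have -> : [set h | chi h == chi e] :\ e = alike chi e by apply/setP => h; rewrite !inE.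
have : k^-1 <= 1 by rewrite invf_le1.
by rewrite mulrBl mul1r; lra.
Qed.

Lemma prob_rainbow_bounds : 12 <= k ->
  expR (- (1 + 25 / k) * mu chi R) <= prob_rainbow chi R /\
  prob_rainbow chi R <= expR (- (1 - 32 / k) * mu chi R).
Proof.
move=> k12; rewrite prob_rainbowE /mu.
have fact_pos : 0 < n`!%:R :> R by rewrite ltr0n fact_gt0.
(* For [n = 0] there is no conflict, and the probability and both bounds equal 1. *)
have [n0|n0] := posnP n.
  have -> : conflicts chi = set0.
    by apply/setP => Q; rewrite in_set0; apply/conflictsP => -[[i _] _]; case: i => m; rewrite n0.
  rewrite avoiding0 cards0 mul0r !mulr0 expR0 cardsT card_Sn divff//.
  by rewrite gt_eqF.
have kn : k <= n%:R by apply: color_bounded_le => //; lra.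
have al e : #|alike chi e|%:R <= (n%:R - 1) / k by apply: color_bounded_alike; lra.
split; first by rewrite ler_pdivlMr//; exact: avoiding_ge.
(* Below 32 the exponent of the upper bound is nonnegative, so the bound is at least 1. *)
rewrite ler_pdivrMr//; have [k32|k32] := leP 32 k; first exact: avoiding_ub.
have nB1 : 0 <= n%:R - 1 :> R by lra.
apply: (@le_trans _ _ (1 * n`!%:R)).
  by rewrite mul1r ler_nat -card_Sn max_card.
rewrite ler_wpM2r// -[leLHS]expR0 ler_expR mulr_ge0 ?divr_ge0 ?mulr_ge0//.
by rewrite oppr_ge0 subr_le0 ler_pdivlMr ?mul1r; lra.
Qed.

Lemma mu_ge0 : 0 <= mu chi R.
Proof.
rewrite /mu; case: n chi => [|m] chi'; first by rewrite mul0r invr0 mulr0.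
by rewrite divr_ge0// mulr_ge0// subr_ge0 ler1n.
Qed.

Lemma mu_le : 12 <= k -> mu chi R <= n%:R / k.
Proof.
move=> k12; have [n0|n0] := posnP n.
  by rewrite /mu (_ : n%:R = 0) ?n0// !mul0r invr0 mulr0.
have kn : k <= n%:R by apply: color_bounded_le => //; lra.
have n1 : 0 < n%:R - 1 :> R by lra.
have al e : #|alike chi e|%:R <= (n%:R - 1) / k by apply: color_bounded_alike; lra.
rewrite /mu ler_pdivrMr ?mulr_gt0 ?ltr0n//.
have le1 := card_alike_pairs [set: edge n] al.
have -> : n%:R / k * (n%:R * (n%:R - 1)) = #|[set: edge n]|%:R * ((n%:R - 1) / k) :> R.
  by rewrite cardsT card_prod card_ord natrM; ring.
apply: le_trans le1; rewrite ler_nat.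
apply: leq_trans (leq_imset_card (fun u : edge n * edge n => [set u.1; u.2]) _).
apply/subset_leq_card/subsetP => Q QU.
have [e eQ] : exists e, e \in Q by apply/set0Pn; rewrite -card_gt0 (card_conflict QU).
have [f fe ->] := conflict_alike QU eQ.
by apply/imsetP; exists (e, f); rewrite // inE in_setT.
Qed.

End ProbabilityBounds.

From mathcomp Require Import all_classical all_reals all_analysis.
Import numFieldNormedType.Exports.

(** * Error terms in the exponent and in the ratio to exp(- mu) *)

Section Asymptotics.

Variables (R : realType) (n : nat) (C : eqType) (chi : edge n -> C) (k : R).
Hypothesis chi_k : color_bounded chi k.

Lemma prob_rainbow_exponent : 12 <= k ->
  exists2 eps : R, `|eps| <= 32 / k &
    prob_rainbow chi R = expR (- (1 + eps) * mu chi R).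
Proof.
move=> k12; have k0 : 0 < k by lra.
have [lo up] := prob_rainbow_bounds chi_k k12.
have P0 : 0 < prob_rainbow chi R by apply: lt_le_trans lo; exact: expR_gt0.
have m0 : 0 <= mu chi R := mu_ge0 R chi.
have := m0; rewrite le_eqVlt => /predU1P[mE|m_gt0].
  (* If [mu] vanishes, the two bounds force the probability to be 1. *)
  exists 0; first by rewrite normr0 divr_ge0// ltW.
  by move: lo up; rewrite -mE !mulr0 expR0 => lo up; apply/eqP; rewrite eq_le up.
exists (- ln (prob_rainbow chi R) / mu chi R - 1); last first.
  rewrite addrCA subrr addr0 mulNr divfK ?gt_eqF// opprK lnK//.
move: lo up; rewrite -{1 2}[prob_rainbow chi R]lnK// !ler_expR => lo up.
have kV : 0 < k^-1 by rewrite invr_gt0.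
rewrite ler_norml; apply/andP; split.
  by rewrite lerBrDr ler_pdivlMr//; lra.
rewrite lerBlDr ler_pdivrMr//.
(* The slack 7 is 32 - 25, the gap between the constants of the two bounds. *)
have : 0 <= 7 * (k^-1 * mu chi R) by rewrite mulr_ge0// mulr_ge0// ltW.
by lra.
Qed.

(** The exponent is off by at most a constant times [mu / k]. By [mu_le] this quotient is at most n
    / k^2, hence at most 1 / A^2. *)
Lemma prob_rainbow_ratio (A : R) : (0 < n)%N -> 12 <= A ->
  A * Num.sqrt n%:R <= k -> `|prob_rainbow chi R * expR (mu chi R) - 1| <= 64 / A.
Proof.
move=> n0 A12 Ak; have A0 : 0 < A by lra.
have sqrt_ge1 : 1 <= Num.sqrt n%:R :> R by rewrite -[leLHS]sqrtr1 ler_sqrt// ler1n.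
have k12 : 12 <= k.
  by apply: (le_trans A12); apply: le_trans Ak; rewrite ler_peMr// ltW.
have k0 : 0 < k by lra.
have [lo up] := prob_rainbow_bounds chi_k k12.
have m0 : 0 <= mu chi R := mu_ge0 R chi.
pose u := mu chi R / k.
have u0 : 0 <= u by rewrite divr_ge0// ltW.
have u_le : u <= A^-1 / 12.
  apply: (@le_trans _ _ (n%:R / k / k)).
    by rewrite ler_wpM2r ?invr_ge0 ?(ltW k0)//; exact: mu_le.
  rewrite ler_pdivrMr// ler_pdivrMr//.
  have : A * Num.sqrt n%:R * (A * Num.sqrt n%:R) <= k * k.
    by apply: ler_pM => //; rewrite mulr_ge0// ?sqrtr_ge0 ?ltW.
  rewrite mulrACA -[Num.sqrt _ * _]expr2 sqr_sqrtr// => le1.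
  rewrite -!mulrA ler_pdivlMl//.
  apply: (@le_trans _ _ (A * A * n%:R / 12)).
    have : 0 <= A * n%:R * (A - 12) by rewrite !mulr_ge0 ?subr_ge0// ltW.
    by lra.
  by move: le1; lra.
have AV : 0 < A^-1 <= 12^-1 by rewrite invr_gt0 A0/= lef_pV2 ?posrE.
move: AV => /andP[AV0 AV1].
have exp_mu0 := expR_gt0 (mu chi R).
rewrite ler_norml; apply/andP; split.
  apply: (@le_trans _ _ (expR (- (25 * u)) - 1)).
    by have := expR_ge1Dx (- (25 * u)); lra.
  rewrite lerB// (_ : - (25 * u) = - (1 + 25 / k) * mu chi R + mu chi R).
    by rewrite expRD ler_wpM2r// ltW.
  by rewrite /u; field; rewrite gt_eqF.
apply: (@le_trans _ _ (expR (32 * u) - 1)).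
  rewrite lerB// (_ : 32 * u = - (1 - 32 / k) * mu chi R + mu chi R).
    by rewrite expRD ler_wpM2r// ltW.
  by rewrite /u; field; rewrite gt_eqF.
have u2 : 32 * u <= 2^-1 by lra.
have : expR (32 * u) <= 1 + 64 * u.
  apply: (le_trans (expR_le_inv _)); first by lra.
  rewrite -[leLHS]mul1r ler_pdivrMr; last by lra.
  have : 0 <= u * (2^-1 - 32 * u) by rewrite mulr_ge0// subr_ge0.
  by lra.
by lra.
Qed.

End Asymptotics.

Local Open Scope classical_set_scope.

Theorem theorem3 (R : realType) :
  exists c1 c2 : R -> R,
    (forall x : R, 12 <= x -> c1 x < 1 /\ 1 < c2 x) /\
    forall (k : nat -> R) (C : nat -> eqType) (chi : forall n : nat, edge n -> C n),
      (forall n : nat, 0 < k n) ->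
      (forall n : nat, color_bounded (chi n) (k n)) ->
      [/\ (forall n : nat, 12 <= k n ->
             expR (- c2 (k n) * mu (chi n) R) <= prob_rainbow (chi n) R /\
             prob_rainbow (chi n) R <= expR (- c1 (k n) * mu (chi n) R)),
          (k n @[n --> \oo] --> +oo ->
             exists eps : nat -> R,
               eps n @[n --> \oo] --> (0 : R) /\
               \forall n \near \oo,
                 prob_rainbow (chi n) R = expR (- (1 + eps n) * mu (chi n) R))
        & (k n / Num.sqrt n%:R @[n --> \oo] --> +oo ->
             exists eps : nat -> R,
               eps n @[n --> \oo] --> (0 : R) /\
               \forall n \near \oo,
                 prob_rainbow (chi n) R = expR (- mu (chi n) R) * (1 + eps n))].
Proof.
exists (fun x => 1 - 32 / x), (fun x => 1 + 25 / x); split.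
  move=> x x12; have : 0 < x^-1 by rewrite invr_gt0; lra.
  by split; lra.
move=> k C chi k_gt0 chi_k; split.
- move=> n k12; exact: prob_rainbow_bounds.
- move=> /cvgryPge k_oo.
  (* Where [k n] is below 12 the error is set to 0; this affects no limit, as [k] tends to
     infinity. *)
  have /choice[eps epsP] n : exists eps : R, 12 <= k n ->
      `|eps| <= 32 / k n /\ prob_rainbow (chi n) R = expR (- (1 + eps) * mu (chi n) R).
    have [k12|_] := leP 12 (k n); last by exists 0.
    by have [eps] := prob_rainbow_exponent (chi_k n) k12; exists eps.
  exists eps; split; last first.
    by near=> n; apply: (epsP n _).2; near: n; exact: k_oo.
  apply/cvgr0Pnorm_le => e e0; near=> n.
  have k12 : 12 <= k n by near: n; exact: k_oo.
  have ke : 32 / e <= k n by near: n; exact: k_oo.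
  apply: (le_trans (epsP n k12).1).
  by rewrite ler_pdivrMr// mulrC -ler_pdivrMr.
- move=> /cvgryPge k_oo.
  exists (fun n => prob_rainbow (chi n) R * expR (mu (chi n) R) - 1); split; last first.
    by near=> n; rewrite addrC subrK mulrCA -expRD addNr expR0 mulr1.
  apply/cvgr0Pnorm_le => e e0; near=> n.
  (* Chosen so that [prob_rainbow_ratio] applies and its bound 64 / A is at most [e]. *)
  pose A : R := Num.max 12 (64 / e).
  have n0 : (0 < n)%N by near: n; exact: nbhs_infty_gt.
  have Ak : A <= k n / Num.sqrt n%:R by near: n; exact: k_oo.
  have A12 : 12 <= A by rewrite le_max lexx.
  have Ae : 64 / e <= A by rewrite le_max lexx orbT.
  apply: (@le_trans _ _ (64 / A)); last first.
    by rewrite ler_pdivrMr; [rewrite mulrC -ler_pdivrMr|lra].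
  apply: (prob_rainbow_ratio (chi_k n)) => //.
  by rewrite -ler_pdivlMr// sqrtr_gt0 ltr0n.
Unshelve. all: by end_near.
Qed.
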